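(* For integers $n\ge 2$ and $m\in\{0,\dots,n\}$ let $q_m=q_m^{(n)}:=\mathbb{P}\bigl(\mathrm{Bi}(n,m/n)\le m\bigr)$. There exists $n_0$ such that for every integer $n\ge n_0$ the following hold: (1) as $m$ ranges over $\{0,\dots,n\}$, the probability $q_m$ is smallest when $m$ is the integer closest to $2n/3$; (2) for every $m\in\{0,\dots,n-1\}$, the difference $q_{m+1}-q_m$ is negative when $m+\tfrac12<2n/3$ and positive when $m+\tfrac12>2n/3$.
   Context: $\mathrm{Bi}(n,p)$ denotes a binomial random variable with $n$ trials and success probability $p\in[0,1]$. The integer closest to $2n/3$ is unique, since $2n/3$ is never a half-integer. *)

(* Defs.v *)
From mathcomp Require Import all_boot all_order all_algebra.
From mathcomp Require Import all_classical all_reals all_analysis.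

Set Implicit Arguments.
Unset Strict Implicit.
Unset Printing Implicit Defensive.

Import Order.TTheory GRing.Theory Num.Theory.

Local Open Scope classical_set_scope.
Local Open Scope ring_scope.

(* [binomial_prob n p] is the law of Bi(n, p) when [0 <= p <= 1]; its values
   lie in [\bar R] and are finite, so [fine] loses nothing. *)
Definition q (R : realType) (n m : nat) : R :=
  fine (binomial_prob n (m%:R / n%:R : R) [set k : nat | (k <= m)%N]).

Definition closest_int (R : realType) (x : R) (z : int) : Prop :=
  forall k : int, `|z%:~R - x| <= `|k%:~R - x|.

(* Main.v *)
(** Put [k = n - 1 - m] and [f s = (m + s)^m (k + 1 - s)^k].  Differentiating
the distribution function of Bi(n, (m + s) / n) in [s] shows that, up to a
positive factor, [q_(m+1) - q_m] is [f 1] minus the integral of [f] over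
[[0, 1]].  To compare the two without integrating, take a polynomial [u] with
[u 0 = 0]: if [u' + u (f' / f) <= 1] on [(0, 1)] and [u 1 > 1], then
[f 1 < f 1 * u 1], which is at most the integral; reversing both inequalities on
[u] reverses the conclusion.

Since [f' / f = m / (m + s) - k / (k + 1 - s)] is monotone in [m] and in [k], it
suffices to treat the critical lines [m = 2 k] and [m = 2 k + 1] ([k] real in
the second case).  There [u] is the second-order expansion in [1 / k] of
[(\int_0^s f) / f s], with a perturbation of order [1 / k ^ 2] that makes the
inequality on [u' + u (f' / f)] strict: on the two lines the unperturbed
[u 1] is [1 + 1 / (40 k^2)] and [1 - 7 / (120 k^2)], which leaves room for it. *)

Require Import Defs.
From mathcomp Require Import all_boot all_order all_algebra.
From mathcomp Require Import all_classical all_reals all_analysis.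
From mathcomp Require Import polyrcf zify ring lra.

Import Order.TTheory GRing.Theory Num.Theory.

Local Open Scope ring_scope.

(** * The scaled distribution function and the comparison criterion *)

(** For [X = m + s] and [Y = n - m - s] this is [n ^ n] times the probability that Bi(n, (m + s) /
    n) is at most [j]. *)
Definition cdf_poly {R : nzRingType} (n j : nat) (X Y : {poly R}) : {poly R} :=
  \sum_(i < j.+1) (X ^+ i * Y ^+ (n - i)) *+ 'C(n, i).

(** The derivatives of consecutive terms telescope, so that only the last one contributes. *)
Lemma deriv_cdf_poly (R : comNzRingType) (n j : nat) (X Y : {poly R}) :
  X^`() = 1 -> Y^`() = -1 -> (j < n)%N ->
  (cdf_poly n j X Y)^`() = - (X ^+ j * Y ^+ (n - j.+1)) *+ ((n - j) * 'C(n, j)).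
Proof.
move=> dX dY; rewrite /cdf_poly; elim: j => [|j IH] jn.
  rewrite big_ord1 expr0 mul1r bin0 mulr1n mul1r deriv_exp dY mulN1r muln1 !subn0.
  by rewrite subn1.
rewrite big_ord_recr /= derivD IH 1?ltnW // derivMn derivM !deriv_exp dX dY.
rewrite mul1r mulN1r /= -subnS mulrnDl mulrnAl -mulrnA mul_bin_left.
by rewrite mulNrn addKr mulrnAr mulrN -mulrnA.
Qed.

Lemma q_cdf (R : realType) (n m : nat) : (0 < n)%N -> (m <= n)%N ->
  q R n m * n%:R ^+ n =
  \sum_(i < m.+1) (m%:R ^+ i * (n - m)%:R ^+ (n - i)) *+ 'C(n, i).
Proof.
move=> n0 mn.
have nz : n%:R != 0 :> R by rewrite pnatr_eq0 -lt0n.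
have p0 : 0 <= m%:R / n%:R :> R by rewrite divr_ge0.
have p1 : ((NngNum p0)%:num <= 1)%R.
  by rewrite /= ler_pdivrMr ?ltr0n// mul1r ler_nat.
rewrite /q (binomial_probE _ p1).
under eq_bigr do rewrite diracE -EFinM.
rewrite sumEFin /= mulr_suml.
have memE (i : nat) : (i \in [set k : nat | (k <= m)%N]%classic) = (i <= m)%N.
  by apply/idP/idP; rewrite in_setE.
rewrite (bigID (fun i : 'I_n.+1 => (i <= m)%N)) /= [X in _ + X]big1 ?addr0;
  last first.
  by move=> i im; rewrite memE (negbTE im) mulr0 mul0r.
rewrite (big_ord_widen_cond n.+1 xpredT
  (fun i => (m%:R ^+ i * (n - m)%:R ^+ (n - i)) *+ 'C(n, i))) //.
apply: eq_bigr => i im.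
rewrite memE im mulr1 [LHS]mulrnAl; congr (_ *+ _).
have ni : (i <= n)%N by rewrite -ltnS.
have -> : n%:R ^+ n = n%:R ^+ i * n%:R ^+ (n - i) :> R by rewrite -exprD subnKC.
rewrite mulrACA -!exprMn; congr (_ ^+ _ * _ ^+ _).
  by rewrite divfK.
by rewrite /unstable.onem mulrBl mul1r divfK// natrB.
Qed.

(** With [f = X ^ m Y ^ k] and [k = n - m - 1], the derivative is proportional to [(u f)' - f]. The
    factor [X * Y] clears the denominators of [f' / f] and absorbs the truncated exponents when [m]
    or [k] is 0. *)
Lemma deriv_potential (R : comNzRingType) (n m : nat) (X Y u : {poly R}) :
  X^`() = 1 -> Y^`() = -1 -> (m < n)%N ->
  X * Y * (cdf_poly n m X Y
           + (X ^+ m * Y ^+ (n - m.+1) * u) *+ ((n - m) * 'C(n, m)))^`() =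
  (X ^+ m * Y ^+ (n - m.+1) *
   (u * (Y *+ m - X *+ (n - m.+1)) - (1 - u^`()) * (X * Y)))
  *+ ((n - m) * 'C(n, m)).
Proof.
move=> dX dY mn.
rewrite derivD deriv_cdf_poly // derivMn !derivM !deriv_exp dX dY mul1r mulN1r.
have expS p i : p * (p ^+ i.-1 *+ i) = p ^+ i *+ i :> {poly R}.
  by case: i => [|i]; rewrite ?mulr0n ?mulr0 // mulrnAr -exprS.
have hX := expS X m; have hY := expS Y (n - m.+1)%N.
move: (n - m.+1)%N hY => k hY.
move: (X ^+ m.-1 *+ m) hX => Xm hX; rewrite (mulNrn _ k).
move: (Y ^+ k.-1 *+ k) hY => Yk hY.
rewrite -mulrnDl [LHS]mulrnAr; congr (_ *+ _).
have -> : X * Y * (- (X ^+ m * Y ^+ k) + ((Xm * Y ^+ k + X ^+ m * - Yk) * u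
    + X ^+ m * Y ^+ k * u^`())) =
  - (X * Y) * (X ^+ m * Y ^+ k) + (X * Xm) * Y * Y ^+ k * u
    - (Y * Yk) * X * X ^+ m * u + X * Y * X ^+ m * Y ^+ k * u^`() by ring.
rewrite hX hY; ring.
Qed.

Lemma q_succ_compare (R : realType) (n m : nat) (u : {poly R}) : (m < n)%N ->
  u.[0] = 0 ->
  let D s := u.[s] * (m%:R * (n%:R - m%:R - s) - (n%:R - m%:R - 1) * (m%:R + s))
             - (1 - u^`().[s]) * ((m%:R + s) * (n%:R - m%:R - s)) in
  ((forall s, 0 < s < 1 -> D s <= 0) -> 1 < u.[1] -> q R n m.+1 < q R n m) /\
  ((forall s, 0 < s < 1 -> 0 <= D s) -> u.[1] < 1 -> q R n m < q R n m.+1).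
Proof.
move=> mn u0 D.
have n0 : (0 < n)%N by apply: leq_ltn_trans mn.
pose X : {poly R} := 'X + m%:R%:P.
pose Y : {poly R} := (n - m)%:R%:P - 'X.
pose A := ((n - m) * 'C(n, m))%N.
pose f : R := m.+1%:R ^+ m * (n - m.+1)%:R ^+ (n - m.+1) *+ A.
have dX : X^`() = 1 by rewrite /X derivD derivX derivC addr0.
have dY : Y^`() = -1 by rewrite /Y derivB derivC derivX sub0r.
(* [W] stands in for the integral: on (0, 1) its derivative is a positive multiple of [D]. *)
pose W := cdf_poly n m X Y + (X ^+ m * Y ^+ (n - m.+1) * u) *+ A.
have hXs s : X.[s] = m%:R + s by rewrite /X !hornerE addrC.
have hYs s : Y.[s] = n%:R - m%:R - s by rewrite /Y !hornerE natrB // ltnW.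
have cdf_horner s : (cdf_poly n m X Y).[s] =
    \sum_(i < m.+1) (X.[s] ^+ i * Y.[s] ^+ (n - i)) *+ 'C(n, i).
  by rewrite /cdf_poly horner_sum; apply: eq_bigr => i _; rewrite hornerMn !hornerE.
have Y1 : Y.[1] = (n - m.+1)%:R by rewrite hYs natrB // -natr1; ring.
have W0 : W.[0] = q R n m * n%:R ^+ n.
  rewrite /W hornerD hornerMn !hornerM u0 mulr0 mul0rn addr0 q_cdf ?(ltnW mn) //.
  rewrite cdf_horner; apply: eq_bigr => i _.
  by rewrite hXs hYs addr0 subr0 natrB // ltnW.
(* The term [i = m + 1] of the sum for [q R n m.+1], absent from [cdf_poly n m], equals [f] because
   [(m + 1) 'C(n, m + 1) = (n - m) 'C(n, m)]; hence the [- 1]. *)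
have W1 : W.[1] = q R n m.+1 * n%:R ^+ n + f * (u.[1] - 1).
  rewrite /W hornerD hornerMn !hornerM !horner_exp q_cdf // big_ord_recr /=.
  rewrite cdf_horner Y1 hXs natr1.
  rewrite exprSr /f -(mulr_natr _ A) -(mulr_natr _ A) -(mulr_natr _ 'C(_, _)).
  rewrite /A -mul_bin_left natrM; ring.
have f0 : 0 < f.
  rewrite /f pmulrn_rgt0 ?muln_gt0 ?subn_gt0 ?mn ?bin_gt0 ?(ltnW mn) //.
  rewrite mulr_gt0 //.
  (* For [m = n - 1] the base is 0, and [0 ^+ 0 = 1] keeps [f] positive. *)
  by case: (n - m.+1)%N => [|k]; rewrite ?expr0 // exprn_gt0.
have nn0 : 0 < n%:R ^+ n :> R by rewrite exprn_gt0 // ltr0n.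
have XYpos s : 0 < s < 1 -> 0 < X.[s] /\ 0 < Y.[s].
  case/andP=> s0 s1; rewrite hXs hYs; split; first by rewrite ltr_wpDl.
  have : m.+1%:R <= n%:R :> R by rewrite ler_nat.
  rewrite -natr1; lra.
(* Otherwise [hornerD] would see through [X] and [Y]. *)
clearbody X Y.
have dW s : 0 < s < 1 -> exists2 c, 0 < c & W^`().[s] = c * D s.
  move=> s01; have [Xs Ys] := XYpos s s01.
  exists (X.[s] ^+ m * Y.[s] ^+ (n - m.+1) *+ A / (X.[s] * Y.[s])).
    rewrite divr_gt0 ?mulr_gt0 // pmulrn_rgt0 ?mulr_gt0 ?exprn_gt0 //.
    by rewrite muln_gt0 ?subn_gt0 mn bin_gt0 ltnW.
  have XYn0 : X.[s] * Y.[s] != 0 by rewrite mulf_neq0 ?gt_eqF.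
  apply: (mulfI XYn0).
  have := congr1 (fun p : {poly R} => p.[s]) (deriv_potential _ n m X Y u dX dY mn).
  rewrite -/A -/W !(hornerM, hornerD, hornerN, hornerMn, hornerC, horner_exp) => ->.
  have -> : D s = u.[s] * (Y.[s] *+ m - X.[s] *+ (n - m.+1))
      - (1 - u^`().[s]) * (X.[s] * Y.[s]).
    rewrite -(mulr_natr _ m) -(mulr_natr _ (n - m.+1)) hXs hYs /D natrB //.
    rewrite -[m.+1%:R]natr1; ring.
  by rewrite [RHS]mulrA [X.[s] * Y.[s] * _ in RHS]mulrC divfK // mulrnAl.
have I0 : 0 \in `[0, 1 : R] by rewrite in_itv /= lexx ler01.
have I1 : 1 \in `[0, 1 : R] by rewrite in_itv /= lexx ler01.
split=> hD u1.
  have : (- W).[0] <= (- W).[1].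
    apply: (@ler_hornerW _ 0 1) => // s; rewrite in_itv /= => s01.
    have [c c0 e] := dW s s01.
    by rewrite derivN hornerN e oppr_ge0 pmulr_rle0 // hD.
  rewrite !hornerN lerN2 W0 W1 => h.
  rewrite -(ltr_pM2r nn0); apply: lt_le_trans h.
  by rewrite ltrDl mulr_gt0 // subr_gt0.
have : W.[0] <= W.[1].
  apply: (@ler_hornerW _ 0 1) => // s; rewrite in_itv /= => s01.
  by have [c c0 ->] := dW s s01; rewrite pmulr_rge0 // hD.
rewrite W0 W1 => h.
rewrite -(ltr_pM2r nn0); apply: le_lt_trans h _.
by rewrite gtrDl pmulr_rlt0 // subr_lt0.
Qed.

(** * The weights on the two critical lines *)

Lemma exprn_itv01 (R : realFieldType) (s : R) (i : nat) :
  0 <= s <= 1 -> 0 <= s ^+ i <= 1.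
Proof. by case/andP=> s0 s1; rewrite exprn_ge0 ?exprn_ile1. Qed.

(* The expansion [u] of the header with [e = 1 / k]; [c] carries the perturbation
   and [d] depends on the critical line. *)
Definition weight {R : realFieldType} (c d e : R) : {poly R} :=
  'X + (e / 2) *: ('X^3 - 'X^2)
  + e ^+ 2 *: (c *: 'X + 2^-1 *: 'X^2 + d *: 'X^3 - 8^-1 *: 'X^4
               + (3 / 20) *: 'X^5).

Lemma horner_weight (R : realFieldType) (c d e s : R) :
  (weight c d e).[s] = s + e * ((s ^+ 3 - s ^+ 2) / 2)
  + e ^+ 2 * (c * s + s ^+ 2 / 2 + d * s ^+ 3 - s ^+ 4 / 8 + 3 / 20 * s ^+ 5).
Proof.
by rewrite /weight !(hornerD, hornerN, hornerZ, hornerX, hornerXn); field.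
Qed.

Lemma horner_weight0 (R : realFieldType) (c d e : R) : (weight c d e).[0] = 0.
Proof. by rewrite horner_weight; field. Qed.

Lemma horner_deriv_weight (R : realFieldType) (c d e s : R) :
  (weight c d e)^`().[s] = 1 + e * (3 / 2 * s ^+ 2 - s)
  + e ^+ 2 * (c + s + 3 * d * s ^+ 2 - s ^+ 3 / 2 + 3 / 4 * s ^+ 4).
Proof.
rewrite /weight !(derivD, derivN, derivZ, derivXn, derivX).
by rewrite !(hornerD, hornerN, hornerZ, hornerMn, hornerC, hornerXn) /=; field.
Qed.

(** Leaving a critical line multiplies an inequality by [u], whose sign then matters. *)
Lemma weight_ge0 (R : realFieldType) (c d e s : R) :
  -1 <= c -> -1 <= d -> 0 <= e <= 1/8 -> 0 <= s <= 1 -> 0 <= (weight c d e).[s].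
Proof.
move=> hc hd /andP[e0 e1] sI.
have /andP[s0 s1] := sI.
have := exprn_itv01 _ s 2 sI; have := exprn_itv01 _ s 3 sI.
have := exprn_itv01 _ s 4 sI.
move=> /andP[h4 h4'] /andP[h3 h3'] /andP[h2 h2'].
have -> : (weight c d e).[s] = s * (1 + e * ((s ^+ 2 - s) / 2)
  + e ^+ 2 * (c + s / 2 + d * s ^+ 2 - s ^+ 3 / 8 + 3 / 20 * s ^+ 4)).
  by rewrite horner_weight; field.
apply: mulr_ge0 => //.
have ds2 : -1 <= d * s ^+ 2 by nra.
have p1 : -1/2 <= (s ^+ 2 - s) / 2 by lra.
have p2 : -3 <= c + s / 2 + d * s ^+ 2 - s ^+ 3 / 8 + 3 / 20 * s ^+ 4 by lra.
nra.
Qed.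

(** The two corrections total at least [-20 e], and [20 / 900 < 1 / 40]. *)
Lemma perturbation_ge0 (R : realFieldType) (e c d : R) :
  0 <= e <= 1/900 -> -10 <= c -> -10 <= d ->
  0 <= e ^+ 2 * (1 / 40 + e * c + e ^+ 2 * d).
Proof.
move=> /andP[e0 e1] hc hd; apply: mulr_ge0; first exact: exprn_ge0.
have /andP[_ e2] : 0 <= e ^+ 2 <= e by rewrite exprn_ge0 //= expr2; nra.
have : -10 * e <= e * c by rewrite mulrC ler_wpM2l.
have : -10 * e ^+ 2 <= e ^+ 2 * d by rewrite mulrC ler_wpM2l // exprn_ge0.
lra.
Qed.

(** This is the line [m = 2 k], divided by [k ^ 2], with [e = 1 / k]. *)
Lemma weight_ineq_critical_lower (R : realFieldType) (e s : R) :
  0 <= e <= 1/900 -> 0 <= s <= 1 ->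
  (weight (-1/80) (-1/2) e).[s] * (e * (2 - 3 * s)) <=
  (1 - (weight (-1/80) (-1/2) e)^`().[s]) * ((2 + e * s) * (1 + e * (1 - s))).
Proof.
move=> /andP[e0 e1] sI.
have /andP[h1 h1'] := sI.
have /andP[h2 h2'] := exprn_itv01 _ s 2 sI.
have /andP[h3 h3'] := exprn_itv01 _ s 3 sI.
have /andP[h4 h4'] := exprn_itv01 _ s 4 sI.
have /andP[h5 h5'] := exprn_itv01 _ s 5 sI.
have /andP[h6 h6'] := exprn_itv01 _ s 6 sI.
(* [u2] is the coefficient of [e ^ 2] in the weight; [a] and [b] are minus those of [e] and [e ^ 2]
   in its derivative. In the difference, orders 0 and 1 cancel, order 2 leaves [-2 c = 1 / 40], and
   [c3], [c4] are the next orders. *)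
pose u2 : R := -1/80 * s + s ^+ 2 / 2 - s ^+ 3 / 2 - s ^+ 4 / 8 + 3 / 20 * s ^+ 5.
pose b : R := 1/80 - s + 3/2 * s ^+ 2 + s ^+ 3 / 2 - 3 / 4 * s ^+ 4.
pose a : R := s - 3/2 * s ^+ 2.
pose c3 := b * (2 - s) + a * s * (1 - s) - (2 - 3 * s) * u2.
pose c4 := b * s * (1 - s).
have c3b : -10 <= c3 by rewrite /c3 /a /b /u2; lra.
have c4b : -10 <= c4 by rewrite /c4 /b; lra.
rewrite -subr_ge0.
suff -> : (1 - (weight (-1/80) (-1/2) e)^`().[s]) * ((2 + e * s) * (1 + e * (1 - s)))
  - (weight (-1/80) (-1/2) e).[s] * (e * (2 - 3 * s)) =
  e ^+ 2 * (1/40 + e * c3 + e ^+ 2 * c4).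
  by apply: perturbation_ge0; rewrite ?e0.
by rewrite horner_weight horner_deriv_weight /c3 /c4 /u2 /b /a; field.
Qed.

(** The same on the line [m = 2 k + 1], with the sign reversed. *)
Lemma weight_ineq_critical_upper (R : realFieldType) (e s : R) :
  0 <= e <= 1/900 -> 0 <= s <= 1 ->
  (1 - (weight (1/30) (-7/12) e)^`().[s]) * ((2 + e + e * s) * (1 + e * (1 - s))) <=
  (weight (1/30) (-7/12) e).[s] * (e * (2 - 3 * s + e * (1 - s))).
Proof.
move=> /andP[e0 e1] sI.
have /andP[h1 h1'] := sI.
have /andP[h2 h2'] := exprn_itv01 _ s 2 sI.
have /andP[h3 h3'] := exprn_itv01 _ s 3 sI.
have /andP[h4 h4'] := exprn_itv01 _ s 4 sI.
have /andP[h5 h5'] := exprn_itv01 _ s 5 sI.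
have /andP[h6 h6'] := exprn_itv01 _ s 6 sI.
pose u2 : R := 1/30 * s + s ^+ 2 / 2 - 7/12 * s ^+ 3 - s ^+ 4 / 8 + 3 / 20 * s ^+ 5.
pose b : R := - 1/30 - s + 7/4 * s ^+ 2 + s ^+ 3 / 2 - 3 / 4 * s ^+ 4.
pose a : R := s - 3/2 * s ^+ 2.
pose c3 := b * (3 - s) + a * (1 - s ^+ 2) - (2 - 3 * s) * u2
  - (1 - s) * ((s ^+ 3 - s ^+ 2) / 2).
pose c4 := b * (1 - s ^+ 2) - (1 - s) * u2.
have c3b : c3 <= 10 by rewrite /c3 /a /b /u2; lra.
have c4b : c4 <= 10 by rewrite /c4 /b /u2; lra.
rewrite -subr_ge0.
(* Order 2 now leaves [2 c = 1 / 15 = 1 / 40 + 1 / 24]. *)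
suff -> : (weight (1/30) (-7/12) e).[s] * (e * (2 - 3 * s + e * (1 - s))) -
  (1 - (weight (1/30) (-7/12) e)^`().[s]) * ((2 + e + e * s) * (1 + e * (1 - s))) =
  e ^+ 2 * (1/40 + e * (- c3) + e ^+ 2 * (- c4)) + e ^+ 2 / 24.
  apply: addr_ge0; last by rewrite divr_ge0 ?exprn_ge0.
  by apply: perturbation_ge0; rewrite ?e0 // lerN2.
by rewrite horner_weight horner_deriv_weight /c3 /c4 /u2 /b /a; field.
Qed.

(** * Away from the critical lines *)

(** For fixed [k], [m / (m + s)] grows with [m], so [m = 2 k] is the worst case. *)
Lemma weight_ineq_lower (R : realFieldType) (k m s : R) :
  900 <= k -> 0 <= m <= 2 * k -> 0 < s < 1 ->
  let u := weight (-1/80) (-1/2) k^-1 in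
  u.[s] * (m * (k + 1 - s) - k * (m + s)) <=
  (1 - u^`().[s]) * ((m + s) * (k + 1 - s)).
Proof.
move=> hk /andP[m0 mk] /andP[s0 s1]; cbv zeta; set u := weight _ _ _.
have k0 : k != 0 by rewrite gt_eqF //; lra.
have eI : 0 <= k^-1 <= 1/900.
  by rewrite invr_ge0 invf_ple ?posrE; lra.
have sI : 0 <= s <= 1 by rewrite !ltW.
have u_ge0 : 0 <= u.[s] by apply: weight_ge0 => //; lra.
have := weight_ineq_critical_lower _ _ _ eI sI; rewrite -/u.
move: u.[s] u_ge0 (1 - u^`().[s]) => U U0 V.
rewrite -(ler_pM2r (_ : 0 < k ^+ 2)) ?exprn_gt0 //; last lra.
have -> : U * (k^-1 * (2 - 3 * s)) * k ^+ 2 = U * (k * (2 - 3 * s)) by field.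
have -> : V * ((2 + k^-1 * s) * (1 + k^-1 * (1 - s))) * k ^+ 2 =
  V * ((2 * k + s) * (k + 1 - s)) by field.
rewrite -(ler_pM2r (_ : 0 < m + s)); last lra.
move=> h; rewrite -(ler_pM2r (_ : 0 < 2 * k + s)); last lra.
have -> : V * ((m + s) * (k + 1 - s)) * (2 * k + s) =
  V * ((2 * k + s) * (k + 1 - s)) * (m + s) by ring.
apply: le_trans h.
rewrite -!mulrA ler_wpM2l // -subr_ge0.
have -> : k * ((2 - 3 * s) * (m + s)) -
  (m * (k + 1 - s) - k * (m + s)) * (2 * k + s) =
  s * (1 - s + k) * (2 * k - m) by ring.
by rewrite !mulr_ge0 //; lra.
Qed.

(** Here [m] is fixed instead, since [k] may be 0. As [- k / (k + 1 - s)] decreases in [k], the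
    worst case is the real [k = (m - 1) / 2] on the critical line. *)
Lemma weight_ineq_upper (R : realFieldType) (k m s : R) :
  0 <= k -> 1801 <= m -> 2 * k + 1 <= m -> 0 < s < 1 ->
  let u := weight (1/30) (-7/12) ((m - 1) / 2)^-1 in
  (1 - u^`().[s]) * ((m + s) * (k + 1 - s)) <=
  u.[s] * (m * (k + 1 - s) - k * (m + s)).
Proof.
move=> k_ge0 hm mk /andP[s0 s1].
cbv zeta; set l := (m - 1) / 2; set u := weight _ _ _.
have hl : 900 <= l by rewrite /l; lra.
have l0 : l != 0 by rewrite gt_eqF //; lra.
have mE : m = 2 * l + 1 by rewrite /l; field.
have kl : k <= l by lra.
clearbody l.
have eI : 0 <= l^-1 <= 1/900.
  by rewrite invr_ge0 invf_ple ?posrE; lra.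
have sI : 0 <= s <= 1 by rewrite !ltW.
have u_ge0 : 0 <= u.[s] by apply: weight_ge0 => //; lra.
have := weight_ineq_critical_upper _ _ _ eI sI; rewrite -/u.
move: u.[s] u_ge0 (1 - u^`().[s]) => U U0 V.
rewrite -(ler_pM2r (_ : 0 < l ^+ 2)) ?exprn_gt0 //; last lra.
have -> : U * (l^-1 * (2 - 3 * s + l^-1 * (1 - s))) * l ^+ 2 =
  U * (l * (2 - 3 * s) + 1 - s) by field.
have -> : V * ((2 + l^-1 + l^-1 * s) * (1 + l^-1 * (1 - s))) * l ^+ 2 =
  V * ((m + s) * (l + 1 - s)) by rewrite mE; field.
rewrite -(ler_pM2r (_ : 0 < k + 1 - s)); last lra.
move=> h; rewrite -(ler_pM2r (_ : 0 < l + 1 - s)); last lra.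
have -> : V * ((m + s) * (k + 1 - s)) * (l + 1 - s) =
  V * ((m + s) * (l + 1 - s)) * (k + 1 - s) by ring.
apply: (le_trans h).
rewrite -!mulrA ler_wpM2l // -subr_ge0.
have -> : (m * (k + 1 - s) - k * (m + s)) * (l + 1 - s) -
  (l * (2 - 3 * s) + 1 - s) * (k + 1 - s) = (m + s) * (l - k) * (1 - s).
  by rewrite mE; ring.
by rewrite !mulr_ge0 //; lra.
Qed.

(** * Signs of the differences *)

(** With [k = n - 1 - m], [6 m + 3 < 4 n] reads [2 m < 4 k + 1], that is [m <= 2 k] by integrality;
    [n >= 3000] then gives [k >= 900]. *)
Lemma q_decreasing (R : realType) (n m : nat) :
  (3000 <= n)%N -> (6 * m + 3 < 4 * n)%N -> q R n m.+1 < q R n m.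
Proof.
move=> hn mn; have ltmn : (m < n)%N by lia.
pose k : R := n%:R - m%:R - 1.
have kE : k = (n - m.+1)%:R by rewrite natrB // -natr1 /k; ring.
have [] := @q_succ_compare R n m (weight (-1/80) (-1/2) k^-1) ltmn.
  exact: horner_weight0.
move=> + _; apply; last first.
  (* [u.[1] - 1] is [1 / 40 - 1 / 80 = 1 / 80] times [k^-1 ^+ 2]. *)
  rewrite horner_weight.
  have : 0 < k^-1 ^+ 2 by rewrite exprn_gt0 // invr_gt0 kE ltr0n; lia.
  lra.
move=> s s01; rewrite subr_le0.
have -> : n%:R - m%:R - s = k + 1 - s by rewrite /k; ring.
rewrite -/k; apply: weight_ineq_lower => //.
  by rewrite kE ler_nat; lia.
by rewrite ler0n kE -natrM ler_nat; lia.
Qed.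

Lemma q_increasing (R : realType) (n m : nat) :
  (3000 <= n)%N -> (m < n)%N -> (4 * n < 6 * m + 3)%N -> q R n m < q R n m.+1.
Proof.
move=> hn ltmn mn.
pose k : R := n%:R - m%:R - 1.
have kE : k = (n - m.+1)%:R by rewrite natrB // -natr1 /k; ring.
have hm : 1801 <= m%:R :> R by rewrite ler_nat; lia.
have [] := @q_succ_compare R n m (weight (1/30) (-7/12) ((m%:R - 1) / 2)^-1) ltmn.
  exact: horner_weight0.
move=> _; apply; last first.
  (* [u.[1] - 1] is [1 / 30 - 7 / 120 = - 1 / 40] times a positive square. *)
  rewrite horner_weight.
  have : 0 < ((m%:R - 1) / 2)^-1 ^+ 2 :> R.
    by rewrite exprn_gt0 // invr_gt0; lra.
  lra.
move=> s s01; rewrite subr_ge0.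
have -> : n%:R - m%:R - s = k + 1 - s by rewrite /k; ring.
rewrite -/k; apply: weight_ineq_upper => //.
  by rewrite kE ler0n.
by rewrite kE -natrM natr1 ler_nat; lia.
Qed.

(** * Location of the minimum *)

Lemma closest_int_half (R : realType) (x : R) (z : int) :
  `|z%:~R - x| <= 1 / 2 -> closest_int x z.
Proof.
move=> zx k; have [->//|kz] := eqVneq k z.
apply: (le_trans zx).
have : 1 <= `|k%:~R - z%:~R| :> R.
  rewrite -intrB -intr_norm (_ : 1 = 1%:~R) // ler_int -gtz0_ge1.
  by rewrite normr_gt0 subr_eq0.
have := ler_distD x (k%:~R : R) z%:~R; rewrite (distrC x); lra.
Qed.

Lemma unimodal_min (R : realType) (f : nat -> R) (n m0 : nat) :
  (m0 <= n)%N ->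
  (forall m, (m < m0)%N -> f m.+1 <= f m) ->
  (forall m, (m0 <= m < n)%N -> f m <= f m.+1) ->
  forall m, (m <= n)%N -> f m0 <= f m.
Proof.
move=> m0n dec inc m mn; have [le_m0m|lt_mm0] := leqP m0 m.
  rewrite -(subnKC le_m0m) in mn *.
  elim: (m - m0)%N mn => [|i IH] mn; first by rewrite addn0.
  rewrite addnS in mn *; apply: le_trans (IH (ltnW mn)) (inc _ _).
  by rewrite leq_addr.
have le_f d : (m + d <= m0)%N -> f (m + d)%N <= f m.
  elim: d => [|d IH] h; first by rewrite addn0.
  by rewrite addnS in h *; apply: le_trans (dec _ h) (IH (ltnW h)).
by rewrite -[X in f X <= _](subnKC (ltnW lt_mm0)) le_f ?subnKC // ltnW.
Qed.

Theorem theorem1p2 (R : realType) :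
  exists n0 : nat, forall n : nat, (2 <= n)%N -> (n0 <= n)%N ->
    (exists m0 : nat,
       [/\ (m0 <= n)%N,
           closest_int (2%:R * n%:R / 3%:R : R) m0%:Z
         & forall m : nat, (m <= n)%N -> q R n m0 <= q R n m])
    /\
    (forall m : nat, (m < n)%N ->
       (m%:R + 1 / 2%:R < 2%:R * n%:R / 3%:R :> R ->
          q R n m.+1 - q R n m < 0) /\
       (2%:R * n%:R / 3%:R < m%:R + 1 / 2%:R :> R ->
          0 < q R n m.+1 - q R n m)).
Proof.
exists 3000%N => n _ hn; split.
  (* The witness is the floor of [2 n / 3 + 1 / 2]. *)
  exists ((4 * n + 3) %/ 6)%N; set m0 := (_ %/ _)%N.
  have m0P : (6 * m0 <= 4 * n + 3 < 6 * m0 + 6)%N by rewrite /m0; lia.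
  have m0n : (m0 <= n)%N by lia.
  split=> //.
    apply: closest_int_half; rewrite ler_norml -pmulrn.
    have h1 : 6 * m0%:R <= 4 * n%:R + 3 :> R.
      by rewrite -!natrM -natrD ler_nat; case/andP: m0P.
    have h2 : 4 * n%:R + 3 < 6 * m0%:R + 6 :> R.
      by rewrite -!natrM -!natrD ltr_nat; case/andP: m0P.
    by apply/andP; split; lra.
  (* For [m < m0] the bound is only [6 m + 3 <= 4 n]; it is strict because [6 m + 3] is odd. *)
  apply: unimodal_min => // m hm; apply: ltW.
    by apply: q_decreasing => //; lia.
  by apply: q_increasing => //; lia.
move=> m mn; split=> h; rewrite ?subr_lt0 ?subr_gt0.
  apply: q_decreasing => //; rewrite -(ltr_nat R).
  by rewrite (natrD _ (6 * m)) !(natrM R _ m) (natrM R _ n); lra.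
apply: q_increasing => //; rewrite -(ltr_nat R).
by rewrite (natrD _ (6 * m)) !(natrM R _ m) (natrM R _ n); lra.
Qed.
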